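(* Let $m>0$. Let $\omega_1:(m,\infty)\to(0,\omega_1(m))$ be a convex and decreasing function with $\omega_1(\infty)=0$, and let $\omega_2:(m,\infty)\to(0,\infty)$ be a convex and increasing function with $\omega_2(\infty)=\infty$. Define $\varphi(t)=m\,\frac{\omega_1(t)}{t}$ for all $t>m$. Then the following assertions hold. 1. The function $\Phi$ defined on $[0,\omega_1(m))$ by $\Phi(0)=0$ and $\Phi(t)=\frac{1}{\varphi^{-1}(t)}$ for $t\ne0$ is such that $\Phi:(0,\omega_1(m))\to(0,\infty)$ is concave and increasing and $\Phi$ is continuous at $0$ (that is, $\lim_{t\searrow0}\Phi(t)=0$). 2. The function $\Psi$ defined on $(\omega_2(m),\infty)$ by $\Psi(t)=\omega_2^{-1}(t)$ is such that $\Psi:(\omega_2(m),\infty)\to(0,\infty)$ is concave and increasing and $\Psi(\infty)=\infty$. 3. For $\Phi$ and $\Psi$ so defined, $1\le\Phi(\omega_1(t))\,\Psi(\omega_2(t))$ for all $t\in(m,\infty)$.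
   Context: For a real-valued function $f$ on an open interval, the value $f(a)$ at an endpoint $a$ of the interval (possibly $a=\infty$) denotes the limit of $f$ at $a$ (possibly infinite). Thus $\omega_1(m)=\lim_{t\searrow m}\omega_1(t)\in(0,\infty]$, $\omega_1(\infty)=\lim_{t\to\infty}\omega_1(t)$, etc. ''Increasing'' and ''decreasing'' are meant strictly. *)

(* Defs.v *)
From mathcomp Require Import all_boot all_order all_algebra.
From mathcomp Require Import all_classical all_reals all_analysis.

Set Implicit Arguments.
Unset Strict Implicit.
Unset Printing Implicit Defensive.

Import Order.TTheory GRing.Theory Num.Theory.
Import numFieldNormedType.Exports.

Local Open Scope classical_set_scope.
Local Open Scope ring_scope.

Definition concave_function (R : realType) (D : set R) (f : R -> R) : Prop :=
  @convex_function R R^o D (\- f).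

(* The value f(a) at the left endpoint a of an open interval, possibly
   infinite.  [lim] is only meaningful when the limit exists, which is always
   the case for the monotone functions it is applied to. *)
Definition right_limit (R : realType) (f : R -> R) (a : R) : \bar R :=
  lim ((f t)%:E @[t --> a^'+]).

(* The set of real numbers strictly between two extended real endpoints. *)
Definition open_segment (R : realType) (a b : \bar R) : set R :=
  [set t | (a < t%:E)%E /\ (t%:E < b)%E].

Section functions.
Variables (R : realType) (m : R).

Definition phi (w1 : R -> R) (t : R) : R := m * (w1 t / t).

(* [pinv D f] is the inverse of the restriction of f to D, with unspecified
   values outside the image f @` D. *)
Definition Phi (w1 : R -> R) (t : R) : R :=
  if t == 0 then 0 else 1 / pinv `]m, +oo[ (phi w1) t.

Definition Psi (w2 : R -> R) (t : R) : R := pinv `]m, +oo[ w2 t.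

End functions.

(* Main.v *)
(* The substitution s = 1/t turns phi into g(s) = m s w1(1/s), which is, up to
   the factor m, the perspective of w1, hence convex, and increasing on
   ]0, 1/m[.  So Phi = g^-1 and Psi = w2^-1 are both inverses of convex
   increasing functions.  The product bound comes from phi < w1 on ]m, +oo[,
   which gives Phi (w1 t) >= Phi (phi t) = 1/t, while Psi (w2 t) = t. *)
Require Import Defs.
From mathcomp Require Import all_boot all_order all_algebra.
From mathcomp Require Import all_classical all_reals all_analysis.
From mathcomp Require Import ring lra.
Import Order.TTheory GRing.Theory Num.Theory.
Import numFieldNormedType.Exports.
Local Open Scope classical_set_scope.
Local Open Scope ring_scope.

(** * Convexity and intervals of the real line *)

(** Trades weights of the unit-interval type for a real [p], so that convexity applies to computed
    weights and [lra] or [field] can treat the result. *)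
Lemma convex_functionP {R : realType} {D : set R} {f : R -> R} :
  @convex_function R R^o D f <->
  (forall p x y : R, 0 <= p <= 1 -> D x -> D y ->
    f (p * x + (1 - p) * y) <= p * f x + (1 - p) * f y).
Proof.
split=> [cf p x y /andP[p0 p1] Dx Dy|cf t x y /set_mem Dx /set_mem Dy].
  by apply: (cf (Itv01 p0 p1)); exact: mem_set.
by apply: cf => //; rewrite ge0 le1.
Qed.

Lemma is_interval_conv {R : realType} {D : set R} {p x y : R} :
  is_interval D -> 0 <= p <= 1 -> D x -> D y -> D (p * x + (1 - p) * y).
Proof.
move=> iD /andP[p0 p1] Dx Dy; have [xy|/ltW yx] := leP x y.
  by apply: (iD x y) => //; apply/andP; split; nra.
by apply: (iD y x) => //; apply/andP; split; nra.
Qed.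

Lemma open_segment_is_interval {R : realType} (a b : \bar R) :
  is_interval (open_segment a b).
Proof.
move=> x y [ax _] [_ yb] z /andP[xz zy]; split.
  by rewrite (lt_le_trans ax)// lee_fin.
by rewrite (le_lt_trans _ yb)// lee_fin.
Qed.

(** * Continuity and inverses of convex increasing functions *)

Section convex_increasing.
Context {R : realType} {D : set R} {f : R -> R}.
Hypotheses (D_itv : is_interval D) (f_convex : @convex_function R R^o D f).
Hypothesis f_incr : {in D &, {homo f : x y / x < y}}.

Let f_le x y : D x -> D y -> x <= y -> f x <= f y.
Proof. by move=> Dx Dy; rewrite (le_mono_in f_incr) ?inE. Qed.

Lemma increasing_inj : {in D &, injective f}.
Proof. exact/inc_inj_in/le_mono_in. Qed.

Lemma increasing_reflect_lt {x y} : D x -> D y -> f x < f y -> x < y.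
Proof. by move=> Dx Dy; rewrite !ltNge; apply: contra; exact: f_le. Qed.

(** [f] is Lipschitz on [[a, b]]: monotonicity bounds its increments below by 0, and convexity
    bounds the slopes above by means of the point [c] beyond [b]. *)
Lemma convex_increasing_continuous {a b c} : D a -> D c -> a <= b -> b < c ->
  {within `[a, b], continuous f}.
Proof.
move=> Da Dc ab bc; have acD z : a <= z -> z <= c -> D z.
  by move=> az zc; apply: (D_itv a c); rewrite ?az.
(* A chord slope over [a, b] is at most that of the chord to c. *)
pose K := (f c - f a) / (c - b).
have lip x y : a <= x -> x <= y -> y <= b -> 0 <= f y - f x <= K * (y - x).
  move=> ax xy yb; have Dx : D x by apply: acD => //; lra.
  have Dy : D y by apply: acD; lra.
  have cx : 0 < c - x by lra.
  rewrite subr_ge0 f_le//= /K.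
  pose p := (c - y) / (c - x).
  have p01 : 0 <= p <= 1.
    by rewrite divr_ge0 ?ler_pdivrMr// ?mul1r; lra.
  have yE : y = p * x + (1 - p) * c by rewrite /p; field; lra.
  have := convex_functionP.1 f_convex p x c p01 Dx Dc.
  rewrite -yE => fy.
  have pE : 1 - p = (y - x) / (c - x) by rewrite /p; field; lra.
  apply: (@le_trans _ _ ((1 - p) * (f c - f x))); first by lra.
  have fax : f a <= f x by exact: f_le.
  have fxc : f x <= f c by apply: f_le => //; lra.
  have -> : (f c - f a) / (c - b) * (y - x) = (y - x) / (c - b) * (f c - f a).
    by ring.
  rewrite pE ler_pM ?divr_ge0//; [lra|lra|lra| |lra].
  by rewrite ler_wpM2l ?lef_pV2 ?posrE; lra.
apply/subspace_continuousP => x /=; rewrite in_itv/= => /andP[ax xb].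
apply/cvgrPdist_lt => e e0.
have K0 : 0 <= K by rewrite divr_ge0// ?subr_ge0 ?f_le//; lra.
(* Only [0 <= K] is at hand, so the radius is [e / (K + 1)]. *)
have K1 : 0 < K + 1 by lra.
have eK : 0 < e / (K + 1) by rewrite divr_gt0.
rewrite near_withinE; near=> y => /=; rewrite in_itv/= => /andP[ay yb].
have xy : `|x - y| < e / (K + 1) by near: y; exact: nbhsx_ballx.
apply: (@le_lt_trans _ _ (K * `|x - y|)).
  have [xy'|/ltW yx] := leP x y.
    have /andP[f0 fK] := lip x y ax xy' yb.
    by rewrite distrC ger0_norm// distrC ger0_norm ?subr_ge0.
  have /andP[f0 fK] := lip y x ay yx xb.
  by rewrite ger0_norm// ger0_norm ?subr_ge0.
move: xy; rewrite ltr_pdivlMr// => /(le_lt_trans _); apply.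
by have := normr_ge0 (x - y); nra.
Unshelve. all: by end_near. Qed.

Lemma convex_increasing_IVT {a b c y} : D a -> D b -> D c -> b < c ->
  f a <= y <= f b -> exists2 x, D x & f x = y.
Proof.
move=> Da Db Dc bc /andP[fay yfb].
have ab : a <= b.
  rewrite leNgt; apply/negP => ba.
  by have := f_incr _ _ (mem_set Db) (mem_set Da) ba; lra.
have [] := IVT ab (convex_increasing_continuous Da Dc ab bc) (v := y).
  by rewrite ge_min fay le_max yfb orbT.
by move=> x; rewrite in_itv/= => axb fx; exists x => //; apply: (D_itv a b).
Qed.

Section inverse.
Context {E : set R} {h : R -> R}.
Hypotheses (E_itv : is_interval E) (hD : set_fun E D h).
Hypothesis hK : {in E, cancel h f}.

Lemma inverse_increasing : {in E &, {homo h : x y / x < y}}.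
Proof.
move=> x y Ex Ey xy; apply: increasing_reflect_lt.
- exact/hD/set_mem.
- exact/hD/set_mem.
- by rewrite !hK.
Qed.

(** By convexity [f] sends the combination of [h x] and [h y] to at most [p * x + (1 - p) * y],
    which is the value of [f] at [h] of the combination. As [f] is increasing, the arguments compare
    in the same way. *)
Lemma inverse_concave : concave_function E h.
Proof.
apply/convex_functionP => p x y p01 Ex Ey /=.
have Dhx := hD _ Ex; have Dhy := hD _ Ey.
have Exy := is_interval_conv E_itv p01 Ex Ey.
rewrite !mulrN -opprD lerN2 leNgt; apply/negP => lt_conv.
have := f_incr _ _ (mem_set (hD _ Exy)) (mem_set (is_interval_conv D_itv p01 Dhx Dhy)) lt_conv.
rewrite hK ?inE// ltNge => /negP; apply.
have := convex_functionP.1 f_convex _ _ _ p01 Dhx Dhy.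
by rewrite !hK ?inE.
Qed.

End inverse.
End convex_increasing.

(** * Endpoint values of monotone functions *)

(** With the limit written as an infimum, a number above it lies above some value of [f], which
    starts the surjectivity argument. The decreasing case uses a supremum likewise. *)
Lemma right_limit_increasing {R : realType} {f : R -> R} {a : R} :
  {in `]a, +oo[ &, {homo f : x y / x < y}} ->
  right_limit f a = ereal_inf [set (f t)%:E | t in `]a, +oo[].
Proof.
move=> f_incr; apply: cvg_lim => //.
apply: (@nondecreasing_at_right_cvge _ _ _ +oo%O) => // x y ax ay.
by rewrite le_eqVlt => /predU1P[->//|xy]; rewrite lee_fin ltW// f_incr.
Qed.

Lemma right_limit_decreasing {R : realType} {f : R -> R} {a : R} :
  {in `]a, +oo[ &, {homo f : x y /~ x < y}} ->
  right_limit f a = ereal_sup [set (f t)%:E | t in `]a, +oo[].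
Proof.
move=> f_decr; apply: cvg_lim => //.
apply: (@nonincreasing_at_right_cvge _ _ _ +oo%O) => // x y ax ay.
by rewrite le_eqVlt => /predU1P[->//|xy]; rewrite lee_fin ltW// f_decr.
Qed.

(** * The inverse of [phi] and the function [Phi] *)

Section phi_inverse.
Variables (R : realType) (m : R) (w : R -> R).
Hypotheses (m_gt0 : 0 < m).
Hypothesis w_range : set_fun `]m, +oo[ (open_segment 0%E (right_limit w m)) w.
Hypothesis w_convex : @convex_function R R^o `]m, +oo[ w.
Hypothesis w_decr : {in `]m, +oo[ &, {homo w : s t /~ s < t}}.
Hypothesis w_oo : w t @[t --> +oo] --> 0.

Let I : set R := `]0, m^-1[.
Let I_itv : is_interval I. Proof. exact: interval_is_interval. Qed.
Let D1 := open_segment 0%E (right_limit w m).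
Let g s := phi m w s^-1.

Let IP s : I s <-> 0 < s /\ m < s^-1.
Proof.
rewrite /I/= in_itv/=; split=> [/andP[s0 sm]|[s0 sm]].
  by split=> //; rewrite -[m]invrK ltf_pV2// posrE invr_gt0.
by rewrite s0/= -[s]invrK ltf_pV2// posrE ?invr_gt0.
Qed.

Let w_gt0 t : m < t -> 0 < w t.
Proof.
move=> mt; have [] := w_range t; first by rewrite /= in_itv/= mt.
by rewrite lte_fin.
Qed.

Let gE s : g s = m * (s * w s^-1).
Proof. by rewrite /g /phi invrK [w _ * s]mulrC. Qed.

Let g_convex : @convex_function R R^o I g.
Proof.
apply/convex_functionP => p x y p01 Ix Iy.
have Is := is_interval_conv I_itv p01 Ix Iy.
move/IP: Ix => [x0 xm]; move/IP: Iy => [y0 ym].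
set s := p * x + (1 - p) * y in Is *; move/IP: Is => [s0 sm].
(* The weight of the perspective: [s * q = p * x] and [s * (1 - q) = (1 - p) * y]. Convexity of [w]
   at [x^-1] and [y^-1] with weight [q], multiplied by [m * s], is the inequality for [g]. *)
pose q := p * x / s.
have [p0 p1] := andP p01.
have q01 : 0 <= q <= 1.
  rewrite /q divr_ge0 ?mulr_ge0 ?(ltW x0) ?(ltW s0)//= ler_pdivrMr// mul1r /s lerDl.
  by rewrite mulr_ge0 ?subr_ge0// ltW.
have sE : s^-1 = q * x^-1 + (1 - q) * y^-1.
  by rewrite /q; move: (lt0r_neq0 s0); rewrite /s => ?; field; lra.
have mx : `]m, +oo[%classic x^-1 by rewrite /= in_itv/= xm.
have my : `]m, +oo[%classic y^-1 by rewrite /= in_itv/= ym.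
have := convex_functionP.1 w_convex q _ _ q01 mx my.
rewrite -sE !gE -(ler_pM2l s0) -(ler_pM2l m_gt0) => /le_trans; apply.
rewrite le_eqVlt; apply/orP; left; apply/eqP.
by rewrite /q; move: (lt0r_neq0 s0); rewrite /s => ?; field.
Qed.

(** Both factors of [s * w s^-1] are positive and increase with [s]. *)
Let g_incr : {in I &, {homo g : s t / s < t}}.
Proof.
move=> s t /set_mem/IP[s0 sm] /set_mem/IP[t0 tm] st.
rewrite !gE ltr_pM2l// ltr_pM ?ltW ?w_gt0//.
by apply: w_decr; rewrite ?in_itv/= ?sm ?tm// ltf_pV2.
Qed.

(** The factor [m / t] is below 1. *)
Let phi_lt t : m < t -> phi m w t < w t.
Proof.
move=> mt; rewrite /phi mulrCA gtr_pMr ?w_gt0// ltr_pdivrMr ?mul1r//.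
exact: lt_trans mt.
Qed.

Let phi_range : set_fun `]m, +oo[ D1 (phi m w).
Proof.
move=> t /= mt; have := w_range t mt; move: mt; rewrite in_itv/= andbT => mt.
move=> [_ wt]; split.
  by rewrite lte_fin mulr_gt0// divr_gt0 ?w_gt0//; exact: lt_trans mt.
by rewrite (lt_trans _ wt)// lte_fin phi_lt.
Qed.

Let I_inv t : m < t -> I t^-1.
Proof. by move=> mt; apply/IP; rewrite invrK invr_gt0 (lt_trans m_gt0). Qed.

Let g_surj y : D1 y -> exists2 s, I s & g s = y.
Proof.
move=> [y0 yw]; rewrite lte_fin in y0.
move: yw; rewrite right_limit_decreasing// => /ereal_sup_gt[_ [t /= mt <-]].
move: mt; rewrite in_itv/= andbT lte_fin => mt yt.
(* Lower end for the intermediate value theorem: [phi u < w u <= y]. *)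
have [u [mu uy]] : exists u, m < u /\ w u <= y.
  near (pinfty_nbhs R) => u; exists u; split; near: u.
    exact: (nbhs_pinfty_gt (num_real _)).
  exact: (cvgr_le 0 w_oo).
(* Upper end: [y < w t] keeps [v] above [m], and [v <= t] gives [phi v >= m * w t / v >= y]. *)
pose v := Num.min t (m * (w t / y)).
have mv : m < v by rewrite lt_min mt/= ltr_pMr// ltr_pdivlMr ?mul1r.
have vt : v <= t by rewrite ge_min lexx.
have vyw : v * y <= m * w t.
  by rewrite -ler_pdivlMr// -mulrA ge_min lexx orbT.
clearbody v.
have v0 : 0 < v by exact: lt_trans mv.
have mv2 : m < (m + v) / 2 by lra.
(* The inverse of the midpoint of [m] and [v] is the point of [I] beyond [v^-1] that continuity up
   to [v^-1] requires. *)
apply: (@convex_increasing_IVT _ _ _ I_itv g_convex g_incr u^-1 v^-1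
  ((m + v) / 2)^-1); try exact: I_inv.
  by rewrite ltf_pV2 ?posrE; have := m_gt0; lra.
rewrite /g !invrK (le_trans (ltW (phi_lt _ mu)))//= /phi.
rewrite mulrA ler_pdivlMr// mulrC (le_trans vyw)// ler_pM2l//.
move: vt; rewrite le_eqVlt => /predU1P[->//|vt].
by rewrite ltW// w_decr// in_itv/= ?mt ?mv.
Unshelve. all: by end_near. Qed.

Lemma phi_bij : set_bij `]m, +oo[ D1 (phi m w).
Proof.
split=> //.
  move=> s t /set_mem/= + /set_mem/=; rewrite !in_itv/= !andbT => ms mt st.
  apply/invr_inj/(increasing_inj g_incr); rewrite ?inE; [exact: I_inv..|].
  by rewrite /g !invrK.
move=> y /g_surj[s /IP[s0 sm] <-]; exists s^-1 => //=.
by rewrite in_itv/= sm.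
Qed.

(** [pinv] is specified only on the image, which the bijection identifies with [D1]. *)
Let pinv_phi y : D1 y ->
  m < pinv `]m, +oo[ (phi m w) y /\ phi m w (pinv `]m, +oo[ (phi m w) y) = y.
Proof.
move=> D1y; have [_ _ phi_surj] := phi_bij; split; last first.
  by apply: (surjpK _ phi_surj); rewrite inE.
have [/(_ y D1y)/= + _ _] := bijpinv_bij (fun=> point) phi_bij.
by rewrite in_itv/= andbT.
Qed.

Let Phi_range : set_fun D1 I (Phi m w).
Proof.
move=> y D1y; have [mt _] := pinv_phi _ D1y.
have [y0 _] := D1y; rewrite lte_fin in y0.
by rewrite /Phi gt_eqF// div1r; exact: I_inv.
Qed.

Let PhiK : {in D1, cancel (Phi m w) g}.
Proof.
move=> y /set_mem D1y; have [_ phiE] := pinv_phi _ D1y.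
have [y0 _] := D1y; rewrite lte_fin in y0.
by rewrite /Phi gt_eqF// div1r /g invrK.
Qed.

Lemma Phi_gt0 : set_fun D1 `]0, +oo[ (Phi m w).
Proof.
by move=> y /Phi_range/IP[Phi0 _]; rewrite /= in_itv/= Phi0.
Qed.

Lemma Phi_concave : concave_function D1 (Phi m w).
Proof.
apply: (inverse_concave I_itv g_convex g_incr _ Phi_range PhiK).
exact: open_segment_is_interval.
Qed.

Lemma Phi_increasing : {in D1 &, {homo Phi m w : s t / s < t}}.
Proof. exact: (inverse_increasing g_incr Phi_range PhiK). Qed.

Lemma Phi_cvg0 : Phi m w t @[t --> 0^'+] --> 0.
Proof.
apply/cvgrPdist_le => e e0.
(* The bound [m^-1 / 2] keeps [s] in [I]. For [0 < y < g s], comparing [g (Phi m w y) = y] with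
   [g s] gives [Phi m w y < s <= e]. *)
pose s := Num.min e (m^-1 / 2).
have m1 : 0 < m^-1 by rewrite invr_gt0.
have s0 : 0 < s by rewrite lt_min e0 divr_gt0.
have Is : I s.
  rewrite /I/= in_itv/= s0 /= /s gt_min; apply/orP; right; lra.
have [_ sm] := (IP s).1 Is.
have D1gs : D1 (g s) by apply: phi_range; rewrite /= in_itv/= sm.
have [gs0 gsw] := D1gs; rewrite lte_fin in gs0.
near=> y.
have y0 : 0 < y by near: y; exact: nbhs_right_gt.
have yg : y < g s by near: y; exact: nbhs_right_lt.
have D1y : D1 y by split; rewrite ?lte_fin// (lt_trans _ gsw)// lte_fin.
have IPhi := Phi_range _ D1y; have [Phi0 _] := (IP _).1 IPhi.
rewrite sub0r normrN gtr0_norm// (@le_trans _ _ s)//; last first.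
  by rewrite ge_min lexx.
apply/ltW/(increasing_reflect_lt g_incr) => //.
by rewrite PhiK ?inE.
Unshelve. all: by end_near. Qed.

(** [g] takes the values [phi m w t] and [w t] at the two sides, and it reflects the order. *)
Lemma Phi_w_ge t : m < t -> t^-1 <= Phi m w (w t).
Proof.
move=> mt; have t0 := lt_trans m_gt0 mt.
have mtI : `]m, +oo[%classic t by rewrite /= in_itv/= mt.
have D1w := w_range _ mtI.
apply/ltW/(increasing_reflect_lt g_incr) => //.
- exact: I_inv.
- exact: Phi_range.
- by rewrite PhiK ?inE// /g invrK phi_lt.
Qed.

End phi_inverse.

(** * The inverse of a convex increasing function on a half-line, and [Psi] *)

Section increasing_inverse.
Variables (R : realType) (m : R) (w : R -> R).
Hypotheses (m_ge0 : 0 <= m).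
Hypothesis w_convex : @convex_function R R^o `]m, +oo[ w.
Hypothesis w_incr : {in `]m, +oo[ &, {homo w : s t / s < t}}.
Hypothesis w_oo : w t @[t --> +oo] --> +oo.

Let I : set R := `]m, +oo[.
Let I_itv : is_interval I. Proof. exact: interval_is_interval. Qed.
Let D2 := open_segment (right_limit w m) +oo%E.

Let IP t : I t <-> m < t.
Proof. by rewrite /I/= in_itv/= andbT. Qed.

Let w_incrI : {in I &, {homo w : s t / s < t}}.
Proof. by move=> s t /set_mem Is /set_mem It; exact: w_incr. Qed.

Let w_range : set_fun I D2 w.
Proof.
move=> t /IP mt; split; last by rewrite ltry.
(* The infimum is at most the value at this midpoint, which is strictly below [w t]. *)
have ms : m < (m + t) / 2 by lra.
rewrite right_limit_increasing//.
apply: (@le_lt_trans _ _ (w ((m + t) / 2))%:E); last first.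
  by rewrite lte_fin w_incr ?in_itv/= ?ms ?mt//; lra.
by apply: ereal_inf_lbound; exists ((m + t) / 2) => //; apply/IP.
Qed.

Let w_surj : set_surj I D2 w.
Proof.
move=> y [+ _]; rewrite right_limit_increasing// => /ereal_inf_lt[_ [a Ia <-]].
rewrite lte_fin => ay.
have [b [mb yb]] : exists b, m < b /\ y <= w b.
  near (pinfty_nbhs R) => b; exists b; split; near: b.
    exact: (nbhs_pinfty_gt (num_real _)).
  exact: cvgry_ge.
(* [a] comes from the infimum, [b] from divergence at infinity, and [b + 1] is the point beyond [b]
   used for continuity. *)
have [|||||x Ix wx] := @convex_increasing_IVT _ _ _ I_itv w_convex w_incrI a b (b + 1) y.
- by [].
- by apply/IP.
- by apply/IP; lra.
- by lra.
- by rewrite (ltW ay).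
by exists x.
Unshelve. all: by end_near. Qed.

Lemma convex_increasing_bij : set_bij I D2 w.
Proof.
by split=> //; exact: increasing_inj.
Qed.

Let PsiK : {in D2, cancel (Psi m w) w}.
Proof. exact: surjpK _ w_surj. Qed.

Lemma Psi_w t : m < t -> Psi m w (w t) = t.
Proof.
move=> mt; apply: pinvKV; last by apply/mem_set/IP.
by have [] := convex_increasing_bij.
Qed.

Let Psi_range : set_fun D2 I (Psi m w).
Proof. by have [] := bijpinv_bij (fun=> point) convex_increasing_bij. Qed.

Lemma Psi_gt0 : set_fun D2 `]0, +oo[ (Psi m w).
Proof.
move=> y /Psi_range/IP mPsi.
by rewrite /= in_itv/= (le_lt_trans m_ge0).
Qed.

Lemma Psi_concave : concave_function D2 (Psi m w).
Proof.
apply: (inverse_concave I_itv w_convex w_incrI _ Psi_range PsiK).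
exact: open_segment_is_interval.
Qed.

Lemma Psi_increasing : {in D2 &, {homo Psi m w : s t / s < t}}.
Proof. exact: (inverse_increasing w_incrI Psi_range PsiK). Qed.

Lemma Psi_cvg : Psi m w t @[t --> +oo] --> +oo.
Proof.
(* The term [m + 1] puts [t] in the domain of [w]; every [y > w t] then has [Psi m w y > t >= A]. *)
apply/cvgryPge => A; pose t := Num.max A (m + 1).
have mt : m < t by rewrite lt_max; apply/orP; right; lra.
have [wt _] := w_range _ ((IP _).2 mt).
near=> y; apply: (@le_trans _ _ t); first by rewrite le_max lexx.
have ty : w t < y by near: y; exact: (nbhs_pinfty_gt (num_real _)).
have D2y : D2 y by split; rewrite ?ltry// (lt_trans wt)// lte_fin.
apply/ltW/(increasing_reflect_lt w_incrI); [by apply/IP|exact: Psi_range|].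
by rewrite PsiK ?inE.
Unshelve. all: by end_near. Qed.

End increasing_inverse.

Theorem theorem2p2 (R : realType) (m : R) (w1 w2 : R -> R)
  (m_gt0 : 0 < m)
  (w1_range : set_fun `]m, +oo[ (open_segment 0%E (right_limit w1 m)) w1)
  (w1_convex : @convex_function R R^o `]m, +oo[ w1)
  (w1_decreasing : {in `]m, +oo[ &, {homo w1 : s t /~ s < t}})
  (w1_oo : w1 t @[t --> +oo] --> 0)
  (w2_range : set_fun `]m, +oo[ `]0, +oo[ w2)
  (w2_convex : @convex_function R R^o `]m, +oo[ w2)
  (w2_increasing : {in `]m, +oo[ &, {homo w2 : s t / s < t}})
  (w2_oo : w2 t @[t --> +oo] --> +oo) :
  let D1 := open_segment 0%E (right_limit w1 m) in
  let D2 := open_segment (right_limit w2 m) +oo%E in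
  [/\ (* phi^-1, hence Phi, is well defined *)
      set_bij `]m, +oo[ D1 (phi m w1) /\
      [/\ Phi m w1 0 = 0,
          set_fun D1 `]0, +oo[ (Phi m w1),
          concave_function D1 (Phi m w1),
          {in D1 &, {homo Phi m w1 : s t / s < t}} &
          Phi m w1 t @[t --> 0^'+] --> 0],
      (* w2^-1, hence Psi, is well defined *)
      set_bij `]m, +oo[ D2 w2 /\
      [/\ set_fun D2 `]0, +oo[ (Psi m w2),
          concave_function D2 (Psi m w2),
          {in D2 &, {homo Psi m w2 : s t / s < t}} &
          Psi m w2 t @[t --> +oo] --> +oo] &
      forall t : R, m < t -> 1 <= Phi m w1 (w1 t) * Psi m w2 (w2 t)].
Proof.
have m_ge0 := ltW m_gt0.
split=> [||t mt].
- split; first exact: phi_bij.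
  split.
  + by rewrite /Phi eqxx.
  + exact: Phi_gt0.
  + exact: Phi_concave.
  + exact: Phi_increasing.
  + exact: Phi_cvg0.
- split; first exact: convex_increasing_bij.
  split.
  + exact: Psi_gt0.
  + exact: Psi_concave.
  + exact: Psi_increasing.
  + exact: Psi_cvg.
have t_gt0 : 0 < t by exact: lt_trans mt.
by rewrite Psi_w// -ler_pdivrMr// div1r Phi_w_ge.
Qed.
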